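(* Let $\mathcal{H}$ be a real Hilbert space, let $A_1, A_2:\mathcal{H}\to 2^{\mathcal{H}}$ be maximally monotone, let $B:\mathcal{H}\to\mathcal{H}$ be monotone and $L$-Lipschitz continuous ($L>0$), let $C:\mathcal{H}\to\mathcal{H}$ be $\beta$-cocoercive ($\beta>0$), and assume that $\mathrm{zer}(A_1+A_2+B+C)\neq\emptyset$. Let $$a=\frac{17\beta L+10+\sqrt{(17\beta L+10)^2+144\beta^2L^2}}{6\beta L},\qquad \gamma\in\left(0,\frac{\beta}{5+(10+\frac{6}{a})\beta L}\right).$$ Let $z_0,y_0,y_{-1}\in\mathcal{H}$ and define for $n\ge0$ $$x_{n+1}=J_{\gamma A_1}z_n,\qquad y_{n+1}=J_{\gamma A_2}\big(2x_{n+1}-z_n-\gamma B(2y_n-y_{n-1})-\gamma Cy_n\big),\qquad z_{n+1}=z_n+y_{n+1}-x_{n+1}.$$ Then: (i) $\{z_n\}$ converges weakly to a point $\bar z\in\mathcal{H}$; (ii) $\{x_n\}$ and $\{y_n\}$ converge weakly to a point $\bar x\in\mathcal{H}$; (iii) $\bar x=J_{\gamma A_1}(\bar z)\in\mathrm{zer}(A_1+A_2+B+C)$.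
   Context: $J_{\gamma A}=(\mathrm{Id}+\gamma A)^{-1}$ denotes the resolvent of a maximally monotone operator $A$. $\mathrm{zer}(T)=\{x:0\in Tx\}$. $C$ is $\beta$-cocoercive if $\langle x-y,Cx-Cy\rangle\ge\beta\|Cx-Cy\|^2$ for all $x,y$. *)

(* Defs.v *)
(* A real Hilbert space is modelled as a complete
   normed module H over R : realType together with an inner product [ip]
   whose induced norm is the norm of H. *)
From HB Require Import structures.
From mathcomp Require Import all_boot all_order all_algebra.
From mathcomp Require Import all_classical all_reals all_analysis.
Set Implicit Arguments. Unset Strict Implicit. Unset Printing Implicit Defensive.
Import Order.TTheory GRing.Theory Num.Theory.
Import numFieldNormedType.Exports.
Local Open Scope ring_scope.
Local Open Scope classical_set_scope.

Section Hilbert.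
Context {R : realType} {H : completeNormedModType R}.

Definition is_inner_product (ip : H -> H -> R) : Prop :=
  [/\ (forall x y, ip x y = ip y x),
      (forall a x y z, ip (a *: x + y) z = a * ip x z + ip y z)
    & (forall x, ip x x = `|x| ^+ 2)].

Definition monotone_op (ip : H -> H -> R) (A : H -> set H) : Prop :=
  forall x y u v, A x u -> A y v -> 0 <= ip (x - y) (u - v).

Definition maximally_monotone (ip : H -> H -> R) (A : H -> set H) : Prop :=
  monotone_op ip A /\
  forall A' : H -> set H, monotone_op ip A' ->
    (forall x u, A x u -> A' x u) -> forall x u, A' x u -> A x u.

Definition monotone_fun (ip : H -> H -> R) (B : H -> H) : Prop :=
  forall x y, 0 <= ip (x - y) (B x - B y).

Definition lipschitz_with (L : R) (B : H -> H) : Prop :=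
  forall x y, `|B x - B y| <= L * `|x - y|.

Definition cocoercive (ip : H -> H -> R) (beta : R) (C : H -> H) : Prop :=
  forall x y, ip (x - y) (C x - C y) >= beta * `|C x - C y| ^+ 2.

(* x = J_{g A} z, i.e. x \in (Id + g A)^{-1} z, i.e. z \in x + g A x *)
Definition resolvent_pt (g : R) (A : H -> set H) (z x : H) : Prop :=
  exists u, A x u /\ z = x + g *: u.

Definition zer4 (A1 A2 : H -> set H) (B C : H -> H) (x : H) : Prop :=
  exists u1 u2, A1 x u1 /\ A2 x u2 /\ u1 + u2 + B x + C x = 0.

Definition weak_cvg (ip : H -> H -> R) (u : nat -> H) (l : H) : Prop :=
  forall w : H, (fun n => ip (u n) w) @ \oo --> ip l w.

End Hilbert.

(* Main.v *)
(* Write [d_n = z_n - z_(n-1)], [e_n = y_(n+1) - y_n], [l = gamma L],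
   [k = gamma / beta]. Monotonicity of [A1] and [A2] is used twice: between the
   iterates and a solution, and between two consecutive iterates. Both give a
   Douglas-Rachford inequality, and their sum contains the gain
   [|d_(n+1)|^2 + |d_(n+1) - d_n|^2], which by firm nonexpansiveness of the
   resolvent of [A1] controls [|e_n|^2]. Monotonicity of [B] at
   [2 y_n - y_(n-1)] makes the terms in [B] telescope, up to the error
   [2 gamma <e_n - e_(n-1), B (2 y_n - y_(n-1)) - B (2 y_(n-1) - y_(n-2))>].
   The step-size condition gives [5 k + 10 l < 1] and [l < 23 / 250], which is
   enough for the gain to absorb all errors, after adding a small quadratic
   storage term in [(d_n, e_(n-1))] to the Lyapunov function. So [d_n] and [e_n]
   tend to 0 and [|z_n - zs|] converges for every fixed point [zs].

   Weak limits are taken along ultrafilters, where they exist by the Riesz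
   theorem. They are fixed points because [A2 + B + C] is maximally monotone,
   which follows from Minty's theorem; both Riesz and Minty come from one
   strongly convex minimization. By Opial's argument the limit does not depend
   on the ultrafilter, hence the sequences converge weakly. *)
Require Import Defs.
From HB Require Import structures.
From mathcomp Require Import all_boot all_order all_algebra.
From mathcomp Require Import all_classical all_reals all_analysis.
From mathcomp Require Import ring lra.
Import Order.TTheory GRing.Theory Num.Theory.
Import numFieldNormedType.Exports.
Local Open Scope ring_scope.
Local Open Scope classical_set_scope.

(** * Inner product *)

Section InnerProduct.
Context {R : realType} {H : completeNormedModType R} {ip : H -> H -> R}.
Context (ipP : is_inner_product ip).

Lemma ipC x y : ip x y = ip y x.
Proof. by case: ipP => + _ _; exact. Qed.

Lemma ip_sq x : ip x x = `|x| ^+ 2.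
Proof. by case: ipP => _ _; exact. Qed.

Lemma ipDl x y z : ip (x + y) z = ip x z + ip y z.
Proof. by case: ipP => _ /(_ 1 x y z) + _; rewrite scale1r mul1r. Qed.

Lemma ip0l z : ip 0 z = 0.
Proof. by have := ipDl 0 0 z; rewrite addr0; lra. Qed.

Lemma ipZl a x z : ip (a *: x) z = a * ip x z.
Proof.
by case: ipP => _ /(_ a x 0 z) + _; rewrite addr0 ip0l addr0.
Qed.

Lemma ipNl x z : ip (- x) z = - ip x z.
Proof. by rewrite -scaleN1r ipZl mulN1r. Qed.

Lemma ipDr x y z : ip z (x + y) = ip z x + ip z y.
Proof. by rewrite ipC ipDl !(ipC z). Qed.

Lemma ipZr a x z : ip z (a *: x) = a * ip z x.
Proof. by rewrite ipC ipZl (ipC z). Qed.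

Lemma ipNr x z : ip z (- x) = - ip z x.
Proof. by rewrite ipC ipNl (ipC z). Qed.

Definition ipE := (ipDl, ipDr, ipNl, ipNr, ipZl, ipZr).

Lemma ip_ge0 x : 0 <= ip x x.
Proof. by rewrite ip_sq sqr_ge0. Qed.

Lemma ip_inj u v : (forall w, ip u w = ip v w) -> u = v.
Proof.
move=> uv; apply/eqP; rewrite -subr_eq0 -normr_eq0 -sqrf_eq0 -ip_sq.
by rewrite ipDl ipNl uv subrr.
Qed.

Lemma ip_le_norm x y : ip x y <= `|x| * `|y|.
Proof.
have [->|x0] := eqVneq x 0; first by rewrite ip0l normr0 mul0r.
have [->|y0] := eqVneq y 0; first by rewrite ipC ip0l normr0 mulr0.
have xy0 : 0 < `|x| * `|y| by rewrite mulr_gt0 // normr_gt0.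
rewrite -(ler_pM2l xy0).
have := ip_ge0 (`|y| *: x - `|x| *: y).
by rewrite !ipE (ipC y x) !ip_sq; lra.
Qed.

Lemma ip_ge_norm x y : - (`|x| * `|y|) <= ip x y.
Proof. by have := ip_le_norm (- x) y; rewrite ipNl normrN; lra. Qed.

Lemma norm_ip_le x y : `|ip x y| <= `|x| * `|y|.
Proof. by rewrite ler_norml ip_ge_norm ip_le_norm. Qed.

(* One Douglas-Rachford step [z |-> z + y - x], written for the differences of
   two runs of the iteration. *)
Lemma dr_step x y z g : 0 <= ip x (z - x) ->
  0 <= ip y (2 *: x - z - y - g) ->
  ip (z + y - x) (z + y - x) + ip (y - x) (y - x) + 2 * ip y g <= ip z z.
Proof. by rewrite !ipE (ipC y x) (ipC z x) (ipC z y); lra. Qed.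

(** The right side exceeds the left by [|z + y - 2 x|^2 + 2 <x, z - x>]. *)
Lemma dr_gain x y z : 0 <= ip x (z - x) ->
  ip y y <= ip (z + y - x) (z + y - x) + ip (y - x) (y - x).
Proof.
have := ip_ge0 (z + y - 2 *: x).
by rewrite !ipE (ipC y x) (ipC z x) (ipC z y); lra.
Qed.

(* The coefficients were found numerically so that the quadratic form bounded
   in [storage_gain] is positive definite. *)
Definition storage (d e : H) : R :=
  3 / 5 * ip d d - 9 / 25 * ip d e + 1 / 10 * ip e e.

Lemma storage_ge0 d e : 0 <= storage d e.
Proof.
rewrite /storage; have := ip_ge0 (d - (3 / 10) *: e).
have := ip_ge0 d; have := ip_ge0 e.
by rewrite !ipE (ipC e d); lra.
Qed.

(** The extreme case [l = 23 / 250], [k = 2 / 125] of [storage_descent], where [5 k + 10 l = 1]. The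
    hypothesis is firm nonexpansiveness of the resolvent of [A1] at consecutive iterates:
    [d - d' + e] is the increment of [x]. *)
Lemma storage_gain d e' d' e : 0 <= ip (d' - e) (d - d' + e) ->
  1 / 200 * ip d' d' + 143 / 125 * ip e e + storage d' e <=
  ip d' d' + ip (d' - d) (d' - d) + 69 / 500 * ip (e + e') (e + e') +
  storage d e'.
Proof.
rewrite /storage => h.
have sq3 (a b : R) u v w : 0 <= ip u u + a ^+ 2 * ip v v + b ^+ 2 * ip w w +
    2 * a * ip u v + 2 * b * ip u w + 2 * a * b * ip v w.
  have := ip_ge0 (u + a *: v + b *: w).
  by rewrite !ipE (ipC v u) (ipC w u) (ipC w v); lra.
(* Squares for a sum-of-squares certificate; [lra] finds their weights and the multiplier of [h]. *)
have := sq3 (- (90 / 119)) (69 / 119) e' d e.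
have := sq3 (- (54 / 31)) (113 / 100) d d' e.
have := sq3 (- (18 / 25)) 0 d' e e.
have := sq3 1 0 d d' e; have := sq3 (-1) 0 d d' e.
have := sq3 0 1 d d' e; have := sq3 0 (-1) d d' e.
have := ip_ge0 e.
move: h; rewrite !ipE.
rewrite (ipC d' d) (ipC e d) (ipC e d') (ipC e' d) (ipC e' e).
lra.
Qed.

(* The bound is affine in [l]: it interpolates between [l = 0] and
   [l = 23 / 250]. *)
Lemma storage_descent (l k : R) d e' d' e :
  0 <= l <= 23 / 250 -> 5 * k + 10 * l <= 1 ->
  0 <= ip (d' - e) (d - d' + e) ->
  1 / 200 * ip d' d' + (5 / 2 * k + 12 * l) * ip e e +
    250 / 23 * l * storage d' e <=
  ip d' d' + ip (d' - d) (d' - d) + 3 / 2 * l * ip (e + e') (e + e') +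
    250 / 23 * l * storage d e'.
Proof.
move=> /andP[l0 l1] kl h; have := storage_gain d e' d' e h.
(* The endpoint [l = 0], where [5 / 2 * k <= 1 / 2]. *)
have : ip e e <= ip d' d' + ip (d' - d) (d' - d).
  have := @dr_gain (d - d' + e) e d.
  have -> : d - (d - d' + e) = d' - e by apply: ip_inj => w; rewrite !ipE; ring.
  have -> : d + e - (d - d' + e) = d' by apply: ip_inj => w; rewrite !ipE; ring.
  have -> : e - (d - d' + e) = d' - d by apply: ip_inj => w; rewrite !ipE; ring.
  by apply; rewrite ipC.
move: (storage d' e) (storage d e') (ip_ge0 e) (ip_ge0 d') (ip_ge0 (d' - d)).
move: (ip d' d') (ip e e) (ip (d' - d) (d' - d)) (ip (e + e') (e + e')).
move=> D E F G S' S E0 D0 F0 h0 h1.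
have := ler_wpM2l l0 h1.
have l1' : 0 <= 23 / 250 - l by lra.
have := ler_wpM2l l1' h0.
have := mulr_ge0 l1' D0; have := mulr_ge0 l1' F0; have := mulr_ge0 l1' E0.
have kl' : 0 <= 1 - (5 * k + 10 * l) by lra.
have := mulr_ge0 kl' E0.
have := mulr_ge0 l0 D0.
lra.
Qed.

End InnerProduct.

(** * Riesz and Minty *)

Section Minimization.
Context {R : realType} {H : completeNormedModType R} {ip : H -> H -> R}.
Context (ipP : is_inner_product ip).

Lemma cvg_ip_bounded {T : Type} {F : set_system T} {FF : Filter F}
    (f g : T -> H) (M : R) :
  `|f t| @[t --> F] --> (0 : R) -> (\near F, `|g F| <= M) ->
  ip (f t) (g t) @[t --> F] --> (0 : R).
Proof.
move=> f0 gM; apply: norm_cvg0.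
apply: (@squeeze_cvgr _ F _ _ (cst 0) (fun t => `|f t| * M)).
- near=> t; rewrite normr_ge0 /=.
  apply: le_trans (norm_ip_le ipP _ _) _; apply: ler_wpM2l => //.
  by near: t.
- exact: cvg_cst.
- by rewrite -[X in _ --> X](mul0r M); apply: cvgMr_tmp.
Unshelve. all: by end_near. Qed.

Lemma cvg_ipl {T : Type} {F : set_system T} {FF : Filter F}
    (f : T -> H) (x w : H) :
  f t @[t --> F] --> x -> ip (f t) w @[t --> F] --> ip x w.
Proof.
move=> fx; apply/subr_cvg0.
have -> : (fun t => ip (f t) w - ip x w) = (fun t => ip (f t - x) w).
  by apply/funext => t; rewrite !(ipE ipP).
apply: (@cvg_ip_bounded _ _ _ (fun t => f t - x) (cst w) `|w|).
- by rewrite -(normr0 H); apply: cvg_norm; apply/subr_cvg0.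
- exact: nearW.
Qed.

Lemma cvg_ip_sq {T : Type} {F : set_system T} {FF : Filter F}
    (f : T -> H) (x : H) :
  f t @[t --> F] --> x -> ip (f t) (f t) @[t --> F] --> ip x x.
Proof.
move=> fx; rewrite (ip_sq ipP) expr2.
have -> : (fun t => ip (f t) (f t)) = (fun t => `|f t| * `|f t|).
  by apply/funext => t; rewrite (ip_sq ipP) expr2.
by apply: cvgM; apply: cvg_norm.
Qed.

Lemma cvg_of_harmonic_cauchy (u : nat -> H) (M : R) : 0 <= M ->
  (forall i j, `|u i - u j| ^+ 2 <= M * (i.+1%:R^-1 + j.+1%:R^-1)) ->
  exists x : H, u @ \oo --> x.
Proof.
move=> M0 hu; suff : cvg (u @ \oo) by move=> cu; exists (lim (u @ \oo)).
apply/cauchy_cvgP; apply: cauchy_exP => e e0.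
have e20 : 0 < e ^+ 2 / (2 * M + 1).
  by rewrite divr_gt0 ?exprn_gt0 // ltr_wpDl // mulr_ge0.
have [N _ hN] := near_infty_natSinv_lt (PosNum e20).
exists (u N); exists N => // n /= Nn; rewrite -ball_normE /=.
rewrite -ltr_sqr ?nnegrE ?normr_ge0 ?(ltW e0) //.
apply: le_lt_trans (hu _ _) _.
have := hN N (leqnn _); have := hN n Nn => /=.
rewrite !ltr_pdivlMr ?ltr_wpDl ?mulr_ge0 //.
have : 0 <= N.+1%:R^-1 :> R by rewrite invr_ge0.
have : 0 < n.+1%:R^-1 :> R by rewrite invr_gt0.
move: (N.+1%:R^-1) (n.+1%:R^-1) => a b; lra.
Qed.

Definition energy (x u : H) (r : R) : R := r + 1 / 2 * (ip x x + ip u u).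

Lemma energy_comb t x u r x' u' r' :
  energy (t *: x + (1 - t) *: x') (t *: u + (1 - t) *: u')
    (t * r + (1 - t) * r') =
  t * energy x u r + (1 - t) * energy x' u' r' -
  1 / 2 * t * (1 - t) * (ip (x - x') (x - x') + ip (u - u') (u - u')).
Proof.
rewrite /energy !(ipE ipP) (ipC ipP x' x) (ipC ipP u' u); lra.
Qed.

(** [K] plays the role of the epigraph of a closed convex function on [H * H], to which [energy]
    adds half the squared norm. Midpoints show that a minimizing sequence is Cauchy, closedness puts
    its limit in [K], and comparison along segments gives the quadratic growth. *)
Lemma energy_min (K : H -> H -> R -> Prop) (c : R) :
  (exists x u r, K x u r) ->
  (forall x u r, K x u r -> c <= energy x u r) ->
  (forall t x u r x' u' r', 0 <= t <= 1 -> K x u r -> K x' u' r' ->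
    K (t *: x + (1 - t) *: x') (t *: u + (1 - t) *: u')
      (t * r + (1 - t) * r')) ->
  (forall (xs us : nat -> H) (rs : nat -> R) x u r,
    (forall n, K (xs n) (us n) (rs n)) ->
    xs @ \oo --> x -> us @ \oo --> u -> rs @ \oo --> r -> K x u r) ->
  exists x0 u0 r0, K x0 u0 r0 /\ forall x u r, K x u r ->
    energy x0 u0 r0 + 1 / 2 * (ip (x - x0) (x - x0) + ip (u - u0) (u - u0)) <=
    energy x u r.
Proof.
move=> [xK [uK [rK KK]]] Kc Kconv Kcl.
pose E := [set e | exists x u r, K x u r /\ e = energy x u r].
have Elb : has_lbound E by exists c => _ [x [u [r [Kx ->]]]]; apply: Kc.
have Einf : has_inf E by split=> //; exists (energy xK uK rK), xK, uK, rK.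
pose m := inf E.
have Em x u r : K x u r -> m <= energy x u r.
  by move=> Kx; apply: ge_inf => //; exists x, u, r.
have /choice[p pP] : forall n : nat, exists q : H * H * R,
    K q.1.1 q.1.2 q.2 /\ energy q.1.1 q.1.2 q.2 < m + n.+1%:R^-1.
  move=> n; have n0 : 0 < n.+1%:R^-1 :> R by rewrite invr_gt0.
  have [_ [x [u [r [Kx ->]]]] xlt] := inf_adherent n0 Einf.
  by exists (x, u, r).
pose xs n := (p n).1.1; pose us n := (p n).1.2; pose rs n := (p n).2.
have hK n : K (xs n) (us n) (rs n) by case: (pP n).
have hE n : energy (xs n) (us n) (rs n) <= m + n.+1%:R^-1.
  by case: (pP n) => _ /ltW.
have hq i j : ip (xs i - xs j) (xs i - xs j) + ip (us i - us j) (us i - us j) <=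
    4 * (i.+1%:R^-1 + j.+1%:R^-1).
  have h2 : 0 <= (1 / 2 : R) <= 1 by apply/andP; split; lra.
  have := Em _ _ _ (Kconv _ _ _ _ _ _ _ h2 (hK i) (hK j)).
  rewrite energy_comb; move: (hE i) (hE j).
  move: (energy _ _ _) (energy _ _ _) (i.+1%:R^-1) (j.+1%:R^-1) => e e' a b.
  lra.
have [x0 xs0] : exists x : H, xs @ \oo --> x.
  apply: (@cvg_of_harmonic_cauchy _ 4) => // i j; rewrite -(ip_sq ipP).
  by apply: le_trans (hq i j); rewrite lerDl ip_ge0.
have [u0 us0] : exists u : H, us @ \oo --> u.
  apply: (@cvg_of_harmonic_cauchy _ 4) => // i j; rewrite -(ip_sq ipP).
  by apply: le_trans (hq i j); rewrite lerDr ip_ge0.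
(* The energies tend to [m], which forces this limit of [rs]. *)
pose r0 := m - 1 / 2 * (ip x0 x0 + ip u0 u0).
have rs0 : rs @ \oo --> r0.
  have -> : rs = (fun n => energy (xs n) (us n) (rs n)) -
      (fun n => 1 / 2 * (ip (xs n) (xs n) + ip (us n) (us n))).
    by apply/funext => n; rewrite !fctE /energy addrK.
  apply: cvgB.
    apply: (@squeeze_cvgr _ _ _ _ (cst m) (fun n => m + harmonic n)).
    - by apply: nearW => n; rewrite /= Em // hE.
    - exact: cvg_cst.
    - rewrite -[X in _ --> X]addr0; apply: cvgD; first exact: cvg_cst.
      exact: cvg_harmonic.
  by apply: cvgMl_tmp; apply: cvgD; apply: cvg_ip_sq.
have K0 := Kcl _ _ _ _ _ _ hK xs0 us0 rs0.
exists x0, u0, r0; split=> // x u r Kx.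
have -> : energy x0 u0 r0 = m by rewrite /energy /r0 subrK.
set Q := ip _ _ + ip _ _.
have hQ t : 0 < t <= 1 -> m + 1 / 2 * (1 - t) * Q <= energy x u r.
  move=> /andP[t0 t1]; have h2 : 0 <= t <= 1 by rewrite (ltW t0).
  have := Em _ _ _ (Kconv _ _ _ _ _ _ _ h2 Kx K0).
  rewrite energy_comb -/Q.
  have -> : energy x0 u0 r0 = m by rewrite /energy /r0 subrK.
  by move=> h; rewrite -(ler_pM2l t0); lra.
(* Instead of letting [t] tend to 0 in [hQ], a deficit [d > 0] is refuted at [t = d / Q], which
   would give [d <= d / 2]. *)
rewrite leNgt; apply/negP => hlt.
pose d := m + 1 / 2 * Q - energy x u r.
have d0 : 0 < d by rewrite /d; lra.
have d1 : 2 * d <= Q.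
  by have := hQ 1; rewrite /d => h; have := h (introT andP (conj ltr01 (lexx _))); lra.
have Q0 : 0 < Q by lra.
have hd : 0 < d / Q <= 1.
  by rewrite divr_gt0 //= ler_pdivrMr //; lra.
have := hQ _ hd.
have -> : 1 / 2 * (1 - d / Q) * Q = 1 / 2 * Q - 1 / 2 * d.
  by field; rewrite gt_eqF.
by rewrite /d in d0 *; lra.
Qed.

(** At the minimizer [x0] of [- phi x + |x|^2 / 2] the growth estimate bounds the linear form
    [<x, x0> - phi x] from below, so this form vanishes. *)
Lemma riesz (phi : H -> R) (M : R) :
  (forall a x y, phi (a *: x + y) = a * phi x + phi y) ->
  (forall x, `|phi x| <= M * `|x|) ->
  exists v, forall w, phi w = ip v w.
Proof.
move=> phil phiM.
have phi0 : phi 0 = 0 by have := phil 1 0 0; rewrite scale1r addr0; lra.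
have phiZ a x : phi (a *: x) = a * phi x.
  by have := phil a x 0; rewrite !addr0 phi0 addr0.
have phiB x y : phi (x - y) = phi x - phi y.
  by rewrite addrC -scaleN1r phil mulN1r addrC.
have [||||x0 [u0 [r0 [_ hmin]]]] := @energy_min
    (fun x u r => - phi x <= r) (- (1 / 2 * M ^+ 2)).
- by exists 0, 0, 0; rewrite phi0 oppr0.
- move=> x u r hr; rewrite /energy; have := ip_ge0 ipP u.
  have := phiM x; rewrite ler_norml !(ip_sq ipP) => /andP[_ h].
  by have := sqr_ge0 (`|x| - M); lra.
- move=> t x u r x' u' r' /andP[t0 t1] h h'; rewrite phil phiZ.
  have t1' : 0 <= 1 - t by lra.
  by have := ler_wpM2l t0 h; have := ler_wpM2l t1' h'; lra.
- move=> xs us rs x u r h xsx _ rsr.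
  apply: (@ler_cvg_to nat \oo _ R (fun n => - phi (xs n)) rs) => //.
    apply: cvgN; apply/subr_cvg0; apply: norm_cvg0.
    apply: (@squeeze_cvgr _ _ _ _ (cst 0) (fun n => M * `|xs n - x|)).
    + by apply: nearW => n; rewrite /= normr_ge0 -phiB phiM.
    + exact: cvg_cst.
    + rewrite -[X in _ --> X](mulr0 M); apply: cvgMl_tmp.
      by rewrite -(normr0 H); apply: cvg_norm; apply/subr_cvg0.
  exact: nearW.
exists x0 => w.
have hlow x : r0 + ip x0 x0 <= ip x x0 - phi x.
  have := hmin x u0 (- phi x) (lexx _); rewrite /energy !(ipE ipP).
  by rewrite (ipC ipP x0 x); lra.
have [/eqP|hw] := eqVneq (ip w x0 - phi w) 0.
  by rewrite subr_eq0 (ipC ipP) => /eqP.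
(* At this multiple of [w] the linear form is one less than its lower bound. *)
have := hlow (((r0 + ip x0 x0 - 1) / (ip w x0 - phi w)) *: w).
by rewrite (ipZl ipP) phiZ -mulrBr divfK //; lra.
Qed.

End Minimization.

(** * Minty's theorem and sums with a Lipschitz map *)

Section MaximalMonotone.
Context {R : realType} {H : completeNormedModType R} {ip : H -> H -> R}.
Context (ipP : is_inner_product ip).

(** Adjoining [(x, u)] to the graph of [A] keeps it monotone. *)
Lemma maximal_related (A : H -> set H) x u : maximally_monotone ip A ->
  (forall q v, A q v -> 0 <= ip (x - q) (u - v)) -> A x u.
Proof.
move=> [mA maxA] h.
apply: (maxA (fun q v => A q v \/ (q = x /\ v = u))); [|by left|by right].
move=> q q' v v' [Aq|[-> ->]] [Aq'|[-> ->]].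
- exact: mA.
- have := h _ _ Aq; rewrite -(opprB q) -(opprB v) (ipNl ipP) (ipNr ipP).
  by rewrite opprK.
- exact: h.
- by rewrite subrr (ip0l ipP).
Qed.

(* The minimizer of [F + |.|^2 / 2], with [F] the Fitzpatrick function of [A],
   has the form [(x, - x)] with [- x \in A x]; [K] is the epigraph of [F]. *)
Lemma minty_zero (A : H -> set H) : maximally_monotone ip A ->
  exists x, A x (- x).
Proof.
move=> maxA; have mA := maxA.1.
have [q0 [v0 A0]] : exists q v, A q v.
  apply: contrapT => nA; apply: (nA); exists 0, 0.
  apply: (maximal_related _ _ _ maxA) => q v Aqv.
  by exfalso; apply: nA; exists q, v.
pose K x u r := forall q v, A q v -> ip x v + ip q u - ip q v <= r.
have KA x u : A x u -> K x u (ip x u).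
  move=> Ax q v Aq; have := mA _ _ _ _ Ax Aq.
  by rewrite !(ipE ipP); lra.
(* The Fitzpatrick function dominates [<x, u>]: otherwise [(x, u)] is related to the whole graph,
   hence lies in it, and testing [K] with it is contradictory. *)
have Kge x u r : K x u r -> ip x u <= r.
  move=> Kx; rewrite leNgt; apply/negP => rlt.
  have Ax : A x u.
    apply: (maximal_related _ _ _ maxA) => q v Aq.
    by have := Kx _ _ Aq; rewrite !(ipE ipP); lra.
  by have := Kx _ _ Ax; lra.
(* The lower bound comes from testing [K] with [(q0, v0)] and completing two squares. *)
have [||||x0 [u0 [r0 [K0 hmin]]]] := @energy_min _ _ _ ipP K
    (- (1 / 2 * (ip v0 v0 + ip q0 q0)) - ip q0 v0).
- by exists q0, v0, (ip q0 v0); apply: KA.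
- move=> x u r Kx; rewrite /energy; have := Kx _ _ A0.
  have := ip_ge0 ipP (x + v0); have := ip_ge0 ipP (u + q0).
  by rewrite !(ipE ipP) (ipC ipP v0 x) (ipC ipP u q0); lra.
- move=> t x u r x' u' r' /andP[t0 t1] Kx Kx' q v Aq.
  have t1' : 0 <= 1 - t by lra.
  have := ler_wpM2l t0 (Kx _ _ Aq); have := ler_wpM2l t1' (Kx' _ _ Aq).
  by rewrite !(ipE ipP); lra.
- move=> xs us rs x u r hK xsx usu rsr q v Aq.
  apply: (@ler_cvg_to nat \oo _ R
    (fun n => ip (xs n) v + ip q (us n) - ip q v) rs) => //.
    apply: cvgB; last exact: cvg_cst.
    apply: cvgD; first exact: cvg_ipl.
    rewrite (ipC ipP q u).
    have -> : (fun n => ip q (us n)) = (fun n => ip (us n) q).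
      by apply/funext => n; rewrite (ipC ipP).
    exact: cvg_ipl.
  by apply: nearW => n; apply: hK.
have hlow x u : A x u -> ip (x0 + u0) (x0 + u0) <= ip (x + u0) (u + x0).
  move=> Ax; have := hmin _ _ _ (KA _ _ Ax); have := Kge _ _ _ K0.
  rewrite /energy !(ipE ipP) (ipC ipP x0 x) (ipC ipP u0 u) (ipC ipP u0 x0).
  lra.
(* By [hlow] the pair [(- u0, - x0)] is related to the whole graph. Put back into [hlow], it forces
   [x0 = - u0]. *)
have A1 : A (- u0) (- x0).
  apply: (maximal_related _ _ _ maxA) => q v /hlow.
  rewrite -!opprD (ipNl ipP) (ipNr ipP) opprK (addrC u0) (addrC x0 v).
  exact: le_trans (ip_ge0 ipP _).
have := hlow _ _ A1; rewrite addNr (ip0l ipP) (ip_sq ipP) => h.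
have : `|x0 + u0| ^+ 2 == 0 by rewrite eq_le h sqr_ge0.
rewrite sqrf_eq0 normr_eq0 addr_eq0 => /eqP x0E.
by exists x0; rewrite {1}x0E.
Qed.

(** Applies [minty_zero] to the operator [t A - h], which is again maximally monotone. *)
Lemma minty (A : H -> set H) (t : R) h : 0 < t -> maximally_monotone ip A ->
  exists q, resolvent_pt t A h q.
Proof.
move=> t0 [mA maxA].
have tV : t^-1 * t = 1 by rewrite mulVf // gt_eqF.
have [|x Ax] := @minty_zero (fun q => [set u | A q (t^-1 *: (u + h))]).
  split.
    move=> x y u v /= /mA h1 /h1.
    have -> : t^-1 *: (u + h) - t^-1 *: (v + h) = t^-1 *: (u - v).
      by rewrite -scalerBr opprD addrACA subrr addr0.
    by rewrite (ipZr ipP) pmulr_rge0 ?invr_gt0.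
  move=> A' mA' sA' x u A'x /=.
  apply: (maxA (fun q => [set v | A' q (t *: v - h)])) => /=.
  - move=> q q' v v' /= /mA' h1 /h1.
    have -> : t *: v - h - (t *: v' - h) = t *: (v - v').
      by apply: (ip_inj ipP) => w; rewrite !(ipE ipP); ring.
    by rewrite (ipZr ipP) pmulr_rge0.
  - move=> q v Aq; apply: sA' => /=.
    by rewrite addrNK scalerA tV scale1r.
  - by rewrite scalerA mulrC tV scale1r addrK.
exists x, (t^-1 *: (- x + h)); split=> //.
by rewrite scalerA mulrC tV scale1r addrA subrr add0r.
Qed.

(** Freezing [M] at [x], Minty's theorem gives a point [q] that solves the resolvent equation which
    [x] should solve. Testing the hypothesis at [q] bounds [|x - q|^2] by the Lipschitz error of
    [M], and [t = 1 / (2 K)] makes this error at most half of [|x - q|^2]. *)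
Lemma maximal_sum_lipschitz (A : H -> set H) (M : H -> H) (K : R) x w :
  0 < K -> maximally_monotone ip A -> lipschitz_with K M ->
  (forall q v, A q v -> 0 <= ip (x - q) (w - (v + M q))) -> A x (w - M x).
Proof.
move=> K0 maxA lM hrel.
pose t := (2 * K)^-1; have t0 : 0 < t by rewrite invr_gt0 mulr_gt0.
have tK : t * K = 1 / 2 by rewrite /t; field; rewrite gt_eqF.
have [q [v [Aq hE]]] := @minty A t (x + t *: (w - M x)) t0 maxA.
have h1 := mulr_ge0 (ltW t0) (hrel _ _ Aq).
have h2 : t * ip (x - q) (M x - M q) <= 1 / 2 * ip (x - q) (x - q).
  rewrite -tK -mulrA ler_pM2l //; apply: le_trans (ip_le_norm ipP _ _) _.
  by rewrite (ip_sq ipP) expr2 mulrCA; apply: ler_wpM2l; [|exact: lM].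
have xq : x = q.
  apply/eqP; rewrite -subr_eq0 -normr_eq0 -sqrf_eq0 eq_le sqr_ge0 andbT.
  rewrite -(ip_sq ipP).
  have : x - q = t *: v - t *: (w - M x).
    apply/eqP; rewrite subr_eq addrAC -subr_eq opprK hE; apply/eqP.
    exact: addrC.
  move=> /(congr1 (ip (x - q))); move: h1 h2.
  move: (x - q) => d; rewrite !(ipE ipP); lra.
move: hE; rewrite -xq => /addrI /(scalerI (lt0r_neq0 t0)) ->.
by rewrite xq.
Qed.

End MaximalMonotone.

(** * Weak limits along ultrafilters *)

Definition weak_cvg_along {R : realType} {H : completeNormedModType R}
    (ip : H -> H -> R) (U : set_system nat) (u : nat -> H) (l : H) :=
  forall w : H, ip (u n) w @[n --> U] --> ip l w.

Section WeakLimits.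
Context {R : realType} {H : completeNormedModType R} {ip : H -> H -> R}.
Context (ipP : is_inner_product ip).

(** Compactness of [[- M, M]] gives a cluster point, and an ultrafilter converges to each of its
    cluster points. *)
Lemma ultra_cvg_bounded (U : set_system nat) (f : nat -> R) (M : R) :
  UltraFilter U -> (\near U, `|f U| <= M) -> exists l : R, f @ U --> l.
Proof.
move=> UU fM; have PU : ProperFilter U by exact: ultra_proper.
have [|p [_ clp]] := @segment_compact R (- M) M (f @ U) _.
  by apply: filterS fM => n /=; rewrite in_itv /= -ler_norml.
exists p => N Np /=; rewrite nbhs_simpl /=.
have [//|UN] := in_ultra_setVsetC (f @^-1` N) UU.
by have [r [nNr Nr]] := clp (~` N) N UN Np.
Qed.

(** If the preimage of some neighbourhood of [l] were not eventual, its complement and [\oo] would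
    lie in a common ultrafilter, along which [f] cannot tend to [l]. *)
Lemma cvg_of_ultra (f : nat -> R) (l : R) :
  (forall U, UltraFilter U -> \oo `<=` U -> f @ U --> l) -> f @ \oo --> l.
Proof.
move=> hU N Nl /=; rewrite nbhs_simpl /=; apply: contrapT => nN.
pose A := ~` (f @^-1` N).
have PA : ProperFilter (within A \oo).
  apply: Build_ProperFilter.
  move=> h0; apply: nN; move: h0; rewrite /within /=.
  by apply: filterS => n nA; apply: contrapT.
have [G [GU sG]] := ultraFilterLemma PA.
have PG : ProperFilter G by exact: ultra_proper.
have sub : \oo `<=` G by move=> P hP; apply: sG; apply: filterS hP => n Pn _.
have GN : G (f @^-1` N) by exact: (hU G GU sub N Nl).
have GA : G A by apply: sG; exact: withinT.
have : G set0 by apply: filterS (filterI GN GA) => n [Nn /(_ Nn)].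
exact: filter_not_empty.
Qed.

(** The limits of [ip (u n) w] define a bounded linear form in [w], which Riesz represents. *)
Lemma weak_limit_ultra (U : set_system nat) (u : nat -> H) (M : R) :
  UltraFilter U -> (\near U, `|u U| <= M) -> exists l, weak_cvg_along ip U u l.
Proof.
move=> UU uM; have PU : ProperFilter U by exact: ultra_proper.
have ipM w : \near U, `|ip (u U) w| <= M * `|w|.
  apply: filterS uM => n un; apply: le_trans (norm_ip_le ipP _ _) _.
  exact: ler_wpM2r.
have /choice[phi phiP] : forall w, exists l : R, ip (u n) w @[n --> U] --> l.
  by move=> w; apply: ultra_cvg_bounded (ipM w).
have [||v vE] := @riesz _ _ _ ipP phi M.
- move=> a x y; apply: (cvg_unique (@norm_hausdorff _ _) (phiP _)).
  have -> : (fun n => ip (u n) (a *: x + y)) =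
      (fun n => a * ip (u n) x + ip (u n) y).
    by apply/funext => n; rewrite !(ipE ipP).
  by apply: cvgD => //; apply: cvgMl_tmp.
- move=> x; apply: (@ler_cvg_to nat U _ R (fun n => `|ip (u n) x|)
    (cst (M * `|x|))) => //.
  + exact: cvg_norm.
  + exact: cvg_cst.
- by exists v => w; rewrite -vE.
Qed.

End WeakLimits.

(** * Real sequences and the step size *)

Lemma sqr_cvg0 {R : realType} (f : nat -> R) :
  f n ^+ 2 @[n --> \oo] --> (0 : R) -> f @ \oo --> (0 : R).
Proof.
move=> /cvgrPdist_le h; apply/cvgrPdist_le => e e0.
have /h : 0 < e ^+ 2 by rewrite exprn_gt0.
apply: filterS => n; rewrite !sub0r !normrN normrX.
by rewrite ler_sqr ?nnegrE ?normr_ge0 ?(ltW e0).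
Qed.

Lemma cvg_shiftl {R : realType} (k : nat) (f : nat -> R) (l : R) :
  f @ \oo --> l -> f (k + n)%N @[n --> \oo] --> l.
Proof.
by rewrite -(cvg_shiftn k); under eq_fun do rewrite addnC.
Qed.

Lemma step_bounds {R : realType} (L beta gamma : R) : 0 < L -> 0 < beta ->
  let a := (17 * beta * L + 10
            + Num.sqrt ((17 * beta * L + 10) ^+ 2 + 144 * beta ^+ 2 * L ^+ 2))
           / (6 * beta * L) in
  0 < gamma -> gamma < beta / (5 + (10 + 6 / a) * beta * L) ->
  gamma * L <= 23 / 250 /\ 5 * (gamma / beta) + 10 * (gamma * L) <= 1.
Proof.
move=> L0 b0 a g0.
rewrite {}/a; set s := Num.sqrt _; pose t := beta * L; pose N := 17 * t + 10 + s.
have t0 : 0 < t by rewrite mulr_gt0.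
have s0 : 0 <= s by rewrite sqrtr_ge0.
(* Hence [N <= 38 * t + 20]. *)
have sle : s <= 21 * t + 10.
  rewrite -ler_sqr ?nnegrE //; last by lra.
  rewrite sqr_sqrtr; first by have := sqr_ge0 t; have := t0; rewrite /t; lra.
  by have := sqr_ge0 (17 * beta * L + 10); have := sqr_ge0 (beta * L); lra.
have N0 : 0 < N by rewrite /N; lra.
have -> : 5 + (10 + 6 / ((17 * beta * L + 10 + s) / (6 * beta * L))) * beta * L =
    5 + 10 * t + 36 * t ^+ 2 / N.
  have -> : 36 * t ^+ 2 / N = 6 * (6 * t / N) * t by ring.
  by rewrite -!(mulrA _ beta L) -/t -/N invf_div mulrDl addrA.
have q0 : 0 <= 36 * t ^+ 2 / N by rewrite divr_ge0 ?mulr_ge0 ?sqr_ge0 // ltW.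
rewrite ltr_pdivlMr; last by lra.
move=> hg; split.
  (* For large [t] this holds because [10 + 36 / 38 > 250 / 23]. *)
  have h : 250 * t <= 23 * (5 + 10 * t + 36 * t ^+ 2 / N).
    suff : (20 * t - 115) * N <= 828 * t ^+ 2.
      by rewrite -ler_pdivlMr // -!mulrA; lra.
    have [tle|tgt] := leP (20 * t - 115) 0.
      by have := mulr_le0_ge0 tle (ltW N0); have := sqr_ge0 t; lra.
    apply: (@le_trans _ _ ((20 * t - 115) * (38 * t + 20))).
      by rewrite ler_pM2l // /N; lra.
    by have := sqr_ge0 t; lra.
  rewrite -(ler_pM2l b0).
  have := ler_wpM2l (ltW g0) h; move: hg; rewrite /t.
  move: (36 * (beta * L) ^+ 2 / N) => q; lra.
rewrite -(ler_pM2l b0).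
have -> : beta * (5 * (gamma / beta) + 10 * (gamma * L)) =
    gamma * (5 + 10 * t) by rewrite /t; field; rewrite gt_eqF.
rewrite mulr1; apply: le_trans (ltW hg).
by rewrite ler_pM2l //; lra.
Qed.

(** * The iteration *)

Section Lyapunov.
Context {R : realType} {H : completeNormedModType R} {ip : H -> H -> R}.
Context (ipP : is_inner_product ip).

Lemma young_cross (t l : R) f g b : 0 < t -> 0 < l -> `|b| <= l * `|g| ->
  - (t * l * ip f f + l / t * ip g g) <= 2 * ip f b.
Proof.
move=> t0 l0 bg.
have b2 : ip b b <= l ^+ 2 * ip g g.
  by rewrite !(ip_sq ipP) -exprMn ler_sqr ?nnegrE // mulr_ge0 // ltW.
have tl0 : 0 < t * l by rewrite mulr_gt0.
rewrite -(ler_pM2l tl0).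
have -> : t * l * - (t * l * ip f f + l / t * ip g g) =
    - (t ^+ 2 * l ^+ 2 * ip f f + l ^+ 2 * ip g g).
  by field; rewrite gt_eqF.
have := ip_ge0 ipP ((t * l) *: f + b).
by rewrite !(ipE ipP) (ipC ipP b f); lra.
Qed.

Lemma cocoercive_lipschitz (beta : R) (C : H -> H) x y : 0 < beta ->
  cocoercive ip beta C -> `|C x - C y| <= beta^-1 * `|x - y|.
Proof.
move=> b0 /(_ x y) cC; have := ip_le_norm ipP (x - y) (C x - C y).
rewrite ler_pdivlMl //.
have [->|c0] := eqVneq `|C x - C y| 0; first by rewrite !mulr0 => _; exact: normr_ge0.
have {}c0 : 0 < `|C x - C y| by rewrite lt0r c0 normr_ge0.
by move=> /(le_trans cC); rewrite expr2 mulrA ler_pM2r.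
Qed.

Lemma resolvent_firmly (A : H -> set H) (g : R) w x w' x' : 0 <= g ->
  monotone_op ip A -> resolvent_pt g A w x -> resolvent_pt g A w' x' ->
  0 <= ip (x - x') (w - w' - (x - x')).
Proof.
move=> g0 mA [u [Au ->]] [u' [Au' ->]].
have -> : x + g *: u - (x' + g *: u') - (x - x') = g *: (u - u').
  by apply: (ip_inj ipP) => v; rewrite !(ipE ipP); ring.
by rewrite (ipZr ipP) mulr_ge0 // mA.
Qed.

Lemma firmly_nonexpansive x z : 0 <= ip x (z - x) -> `|x| <= `|z|.
Proof.
rewrite (ipDr ipP) (ipNr ipP) (ip_sq ipP) => h.
have [->|x0] := eqVneq `|x| 0; first by rewrite normr_ge0.
have {}x0 : 0 < `|x| by rewrite lt0r x0 normr_ge0.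
by rewrite -(ler_pM2l x0) -expr2; have := ip_le_norm ipP x z; lra.
Qed.

(** The algebra of one descent step, with [e1], [e2], [e3] successive increments of [y] and [b1],
    [b2] values of [B] at extrapolated points, relative to the solution. The [B] terms telescope by
    [<e3 - e2, b2> + <e3, b2 - b1> = <e3, b2> - <e2, b1> + <e3 - e2, b2 - b1>]. *)
Lemma descent_of_errors (g l k Z' Z D' D F S' S : R) q e1 e2 e3 b1 b2 c2 dc :
  0 <= g -> 0 <= l ->
  Z' + D' + 2 * ip (q + (e3 - e2)) (g *: b2 + g *: c2) <= Z ->
  D' + F + 2 * ip e3 (g *: (b2 - b1) + g *: dc) <= D ->
  0 <= ip q b2 ->
  - (3 / 2 * l * ip (e3 - e2) (e3 - e2)
     + l / (3 / 2) * ip (2 *: e2 - e1) (2 *: e2 - e1)) <=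
    2 * ip (e3 - e2) (g *: (b2 - b1)) ->
  - (k / 2 * ip e3 e3) <= 2 * g * ip (q + (e3 - e2)) c2 ->
  - (1 * k * ip e3 e3 + k / 1 * ip e2 e2) <= 2 * ip e3 (g *: dc) ->
  1 / 200 * D' + (5 / 2 * k + 12 * l) * ip e3 e3 + 250 / 23 * l * S' <=
    D' + F + 3 / 2 * l * ip (e3 + e2) (e3 + e2) + 250 / 23 * l * S ->
  Z' + D' + 2 * g * ip e3 b2 + (9 * l + k) * ip e3 e3 + 2 * l * ip e2 e2
    + 250 / 23 * l * S' + 1 / 200 * D' <=
  Z + D + 2 * g * ip e2 b1 + (9 * l + k) * ip e2 e2 + 2 * l * ip e1 e1
    + 250 / 23 * l * S.
Proof.
move=> g0 l0 hA hB h5 hb hc hdc hS.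
have {h5} := mulr_ge0 g0 h5.
(* Removes a cross term: [|2 e2 - e1|^2 + 2 |e2 + e1|^2 = 6 |e2|^2 + 3 |e1|^2]. The parallelogram
   law does the same for [e3 - e2] and [e3 + e2]. *)
have := mulr_ge0 l0 (ip_ge0 ipP (e2 + e1)).
move: hA hB hb hc hdc hS; rewrite !(ipE ipP) (ipC ipP e3 e2) (ipC ipP e2 e1).
lra.
Qed.

(** * Descent and lower bound of the Lyapunov function *)

Context {A1 A2 : H -> set H} {B C : H -> H} {L beta gamma : R}.
Context (mA1 : monotone_op ip A1) (mA2 : monotone_op ip A2).
Context (mB : monotone_fun ip B) (lB : lipschitz_with L B).
Context (cC : cocoercive ip beta C).
Context (L0 : 0 < L) (beta0 : 0 < beta) (gamma0 : 0 < gamma).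
Context (step_le : gamma * L <= 23 / 250).
Context (step_le1 : 5 * (gamma / beta) + 10 * (gamma * L) <= 1).

Let l := gamma * L.
Let k := gamma / beta.

(** The stationary states of the iteration: [z] rests at [zs], and both [x] and [y] at [p]. *)
Definition dr_fixpoint zs p := resolvent_pt gamma A1 zs p /\
  resolvent_pt gamma A2 (2 *: p - zs - gamma *: B p - gamma *: C p) p.

(** The arguments are consecutive iterates; the [B] term pairs the last increment of [y] with the
    value of [B] used in computing [y2]. *)
Definition lyap p zs y0 y1 y2 z1 z2 : R :=
  ip (z2 - zs) (z2 - zs) + ip (z2 - z1) (z2 - z1)
  + 2 * gamma * ip (y2 - y1) (B (2 *: y1 - y0) - B p)
  + (9 * l + k) * ip (y2 - y1) (y2 - y1) + 2 * l * ip (y1 - y0) (y1 - y0)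
  + 250 / 23 * l * storage (ip := ip) (z2 - z1) (y2 - y1).

Lemma lyap_descent p zs y0 y1 y2 y3 x2 x3 z1 z2 z3 :
  dr_fixpoint zs p ->
  resolvent_pt gamma A1 z1 x2 -> resolvent_pt gamma A1 z2 x3 ->
  resolvent_pt gamma A2
    (2 *: x2 - z1 - gamma *: B (2 *: y1 - y0) - gamma *: C y1) y2 ->
  resolvent_pt gamma A2
    (2 *: x3 - z2 - gamma *: B (2 *: y2 - y1) - gamma *: C y2) y3 ->
  z2 = z1 + y2 - x2 -> z3 = z2 + y3 - x3 ->
  lyap p zs y1 y2 y3 z2 z3 + 1 / 200 * ip (z3 - z2) (z3 - z2) <=
    lyap p zs y0 y1 y2 z1 z2.
Proof.
move=> [rs1 rs2] r2 r3 s2 s3 z2E z3E.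
have g0 := ltW gamma0.
have l0 : 0 < l by rewrite mulr_gt0.
have k0 : 0 < k by rewrite divr_gt0.
(* Splits off the extrapolated point [2 y2 - y1], where monotonicity of [B] is applied. *)
have q_eq : y3 - p = (2 *: y2 - y1 - p) + ((y3 - y2) - (y2 - y1)).
  by apply: (ip_inj ipP) => w; rewrite !(ipE ipP); ring.
have hsol := resolvent_firmly _ _ _ _ _ _ g0 mA1 r3 rs1.
have hcons := resolvent_firmly _ _ _ _ _ _ g0 mA1 r3 r2.
rewrite /lyap; set b1 := B (2 *: y1 - y0) - B p; set b2 := B (2 *: y2 - y1) - B p.
have dE : z3 - z2 = y3 - x3.
  by rewrite z3E; apply: (ip_inj ipP) => w; rewrite !(ipE ipP); ring.
apply: (descent_of_errors _ _ _ _ _ _ _ (ip (z3 - z2 - (z2 - z1)) (z3 - z2 - (z2 - z1)))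
  _ _ (2 *: y2 - y1 - p) _ _ _ _ _ (C y2 - C p) (C y2 - C y1)) => //.
- exact: ltW.
- rewrite -q_eq.
  have := dr_step ipP (x3 - p) (y3 - p) (z2 - zs)
    (gamma *: b2 + gamma *: (C y2 - C p)) hsol.
  have -> : z2 - zs + (y3 - p) - (x3 - p) = z3 - zs.
    by rewrite z3E; apply: (ip_inj ipP) => w; rewrite !(ipE ipP); ring.
  have -> : y3 - p - (x3 - p) = z3 - z2.
    by rewrite dE; apply: (ip_inj ipP) => w; rewrite !(ipE ipP); ring.
  apply; have := resolvent_firmly _ _ _ _ _ _ g0 mA2 s3 rs2.
  congr (0 <= ip _ _).
  by rewrite /b2; apply: (ip_inj ipP) => w; rewrite !(ipE ipP); ring.
- have := dr_step ipP (x3 - x2) (y3 - y2) (z2 - z1)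
    (gamma *: (b2 - b1) + gamma *: (C y2 - C y1)) hcons.
  have -> : z2 - z1 + (y3 - y2) - (x3 - x2) = z3 - z2.
    by rewrite dE z2E; apply: (ip_inj ipP) => w; rewrite !(ipE ipP); ring.
  have -> : y3 - y2 - (x3 - x2) = z3 - z2 - (z2 - z1).
    by rewrite dE z2E; apply: (ip_inj ipP) => w; rewrite !(ipE ipP); ring.
  apply; have := resolvent_firmly _ _ _ _ _ _ g0 mA2 s3 s2.
  congr (0 <= ip _ _).
  by rewrite /b1 /b2; apply: (ip_inj ipP) => w; rewrite !(ipE ipP); ring.
- apply: young_cross; [lra|by []|].
  have -> : gamma *: (b2 - b1) =
      gamma *: (B (2 *: y2 - y1) - B (2 *: y1 - y0)).
    by rewrite /b1 /b2; apply: (ip_inj ipP) => w; rewrite !(ipE ipP); ring.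
  rewrite normrZ gtr0_norm // /l -mulrA ler_pM2l //.
  apply: le_trans (lB _ _) _.
  have -> : 2 *: (y2 - y1) - (y1 - y0) = 2 *: y2 - y1 - (2 *: y1 - y0).
    by apply: (ip_inj ipP) => w; rewrite !(ipE ipP); ring.
  by [].
- rewrite -q_eq.
  have := cC y2 p; rewrite -(ip_sq ipP); move: (C y2 - C p) => c hc.
  have -> : y3 - p = (y2 - p) + (y3 - y2).
    by apply: (ip_inj ipP) => w; rewrite !(ipE ipP); ring.
  (* Cocoercivity supplies [2 gamma beta |c|^2], exactly what completes the square
     [k / 2 * |e + 2 beta c|^2]. *)
  have := ip_ge0 ipP (y3 - y2 + (2 * beta) *: c).
  move: hc; rewrite (ipDl ipP (y2 - p)).
  move: (y2 - p) (y3 - y2) => u e; rewrite !(ipE ipP) (ipC ipP c e) => hc.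
  move=> hsq; have := ler_wpM2l g0 hc; have := mulr_ge0 (ltW k0) hsq.
  have -> : gamma = k * beta by rewrite /k divfK // gt_eqF.
  lra.
- apply: young_cross => //.
  rewrite normrZ gtr0_norm // /k -mulrA ler_pM2l //.
  exact: cocoercive_lipschitz.
- apply: storage_descent => //; first by rewrite ltW.
  have := hcons; rewrite (ipC ipP); congr (0 <= ip _ _).
    by rewrite dE z2E; apply: (ip_inj ipP) => w; rewrite !(ipE ipP); ring.
  by rewrite dE z2E; apply: (ip_inj ipP) => w; rewrite !(ipE ipP); ring.
Qed.

(** Only the [B] term can be negative. Its Lipschitz bound involves [|2 y1 - y0 - p|], which is
    estimated through [z2 - zs] because the resolvent of [A1] is nonexpansive. *)
Lemma lyap_lower p zs y0 y1 y2 x2 z1 z2 :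
  resolvent_pt gamma A1 zs p -> resolvent_pt gamma A1 z1 x2 ->
  z2 = z1 + y2 - x2 ->
  1 / 2 * `|z2 - zs| ^+ 2 + 1 / 2 * `|z2 - z1| ^+ 2
    <= lyap p zs y0 y1 y2 z1 z2 /\
  `|y2 - p| <= `|z2 - zs| + 2 * `|z2 - z1|.
Proof.
move=> rs r2 z2E.
have l0 : 0 < l by rewrite mulr_gt0.
have k0 : 0 < k by rewrite divr_gt0.
have /firmly_nonexpansive xz := resolvent_firmly _ _ _ _ _ _ (ltW gamma0) mA1 r2 rs.
have y2p : `|y2 - p| <= `|z2 - zs| + 2 * `|z2 - z1|.
  have -> : y2 - p = (x2 - p) + (z2 - z1).
    by rewrite z2E; apply: (ip_inj ipP) => w; rewrite !(ipE ipP); ring.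
  apply: le_trans (ler_normD _ _) _.
  have : `|z1 - zs| <= `|z2 - zs| + `|z2 - z1|.
    have -> : z1 - zs = (z2 - zs) - (z2 - z1).
      by apply: (ip_inj ipP) => w; rewrite !(ipE ipP); ring.
    exact: ler_normB.
  by move: xz; lra.
split=> //; rewrite /lyap.
have : `|2 *: y1 - y0 - p| <= `|z2 - zs| + 2 * `|z2 - z1| + `|y2 - y1| + `|y1 - y0|.
  have -> : 2 *: y1 - y0 - p = (y2 - p) - (y2 - y1) + (y1 - y0).
    by apply: (ip_inj ipP) => w; rewrite !(ipE ipP); ring.
  apply: le_trans (ler_normD _ _) _; rewrite lerD2r.
  by apply: le_trans (ler_normB _ _) _; rewrite lerD2r.
have := lB (2 *: y1 - y0) p.
have := ip_ge_norm ipP (y2 - y1) (B (2 *: y1 - y0) - B p).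
have := storage_ge0 ipP (z2 - z1) (y2 - y1).
rewrite !(ip_sq ipP).
have := normr_ge0 (z2 - zs); have := normr_ge0 (z2 - z1).
have := normr_ge0 (y2 - y1); have := normr_ge0 (y1 - y0).
move: (storage _ _) (ip _ _) `|z2 - zs| `|z2 - z1| `|y2 - y1| `|y1 - y0|.
move: `|2 *: y1 - y0 - p| `|B _ - B p| => h b S T a d e e' e'0 e0 d0 a0 S0 hT hb hh.
have hT' : - (2 * l * e * (a + 2 * d + e + e')) <= 2 * gamma * T.
  have : - (2 * gamma * (e * b)) <= 2 * gamma * T.
    by rewrite -mulrN ler_wpM2l // mulr_ge0 // ltW.
  apply: le_trans; rewrite lerN2.
  have -> : 2 * l * e * (a + 2 * d + e + e') =
      2 * gamma * (e * (L * (a + 2 * d + e + e'))) by rewrite /l; ring.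
  apply: ler_wpM2l; first by rewrite mulr_ge0 // ltW.
  apply: ler_wpM2l => //; apply: le_trans hb _.
  by apply: ler_wpM2l; first exact: ltW.
(* These squares split the products of [e] with [a], [d] and [e']; since [l <= 1 / 10], the
   quadratic terms of [lyap] cover the result. *)
have := sqr_ge0 (a - 2 * l * e).
have l1 : 0 <= 1 / 10 - l by have := step_le; rewrite -/l; lra.
have := mulr_ge0 (mulr_ge0 (ltW l0) l1) (sqr_ge0 e).
have := mulr_ge0 (ltW l0) (sqr_ge0 (e - d)).
have := mulr_ge0 (ltW l0) (sqr_ge0 (e - e')).
have := mulr_ge0 l1 (sqr_ge0 d).
have := mulr_ge0 (ltW k0) (sqr_ge0 e).
have := mulr_ge0 (ltW l0) (sqr_ge0 e).
have := mulr_ge0 (ltW l0) (sqr_ge0 e').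
have := mulr_ge0 (ltW l0) S0.
have := sqr_ge0 d.
move: hT'; lra.
Qed.

(** * Weak convergence of the iterates *)

Context (maxA1 : maximally_monotone ip A1) (maxA2 : maximally_monotone ip A2).
Context (x y yp z : nat -> H).
Context (ypS : forall n, yp n.+1 = y n).
Context (hx : forall n, resolvent_pt gamma A1 (z n) (x n.+1)).
Context (hy : forall n, resolvent_pt gamma A2
  (2 *: x n.+1 - z n - gamma *: B (2 *: y n - yp n) - gamma *: C (y n))
  (y n.+1)).
Context (hz : forall n, z n.+1 = z n + y n.+1 - x n.+1).

Lemma fejer zs p : dr_fixpoint zs p ->
  [/\ exists M, forall n, `|z n.+2 - zs| <= M,
      `|z n.+1 - z n| @[n --> \oo] --> (0 : R),
      `|y n.+1 - y n| @[n --> \oo] --> (0 : R) &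
      exists c : R, ip (z n - zs) (z n - zs) @[n --> \oo] --> c].
Proof.
move=> fix_p; have g0 := ltW gamma0.
have l0 : 0 <= l by rewrite mulr_ge0 // ltW.
(* Only steps from index 1 on enter, where [ypS] identifies [yp] with the preceding [y]. *)
pose V n := lyap p zs (y n) (y n.+1) (y n.+2) (z n.+1) (z n.+2).
have Vlow n := lyap_lower p zs (y n) (y n.+1) (y n.+2) (x n.+2) (z n.+1)
  (z n.+2) fix_p.1 (hx n.+1) (hz n.+1).
have Vdec n : V n.+1 + 1 / 200 * ip (z n.+3 - z n.+2) (z n.+3 - z n.+2) <= V n.
  have hy1 := hy n.+1; have hy2 := hy n.+2; rewrite !ypS in hy1 hy2.
  exact: lyap_descent fix_p (hx n.+1) (hx n.+2) hy1 hy2 (hz n.+1) (hz n.+2).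
have V0 n : 0 <= V n.
  apply: le_trans (Vlow n).1.
  by have := sqr_ge0 `|z n.+2 - zs|; have := sqr_ge0 `|z n.+2 - z n.+1|; lra.
have VS n : V n.+1 <= V n.
  by have := Vdec n; have := ip_ge0 ipP (z n.+3 - z n.+2); lra.
have Vcvg : cvg (V @ \oo).
  apply: nonincreasing_is_cvgn; last by exists 0 => _ [n _ <-].
  exact/nonincreasing_seqP.
have Vle n : V n <= V 0%N by elim: n => // n; apply: le_trans.
have dz : `|z n.+1 - z n| @[n --> \oo] --> (0 : R).
  rewrite -(cvg_shiftn 2); apply: sqr_cvg0.
  apply: (@squeeze_cvgr _ _ _ _ (cst 0) (fun n => 200 * (V n - V n.+1))).
  - apply: nearW => n; rewrite /= sqr_ge0 /= addn2 -(ip_sq ipP).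
    by have := Vdec n; lra.
  - exact: cvg_cst.
  - rewrite -[X in _ --> X](mulr0 200); apply: cvgMl_tmp.
    rewrite -(subrr (lim (V @ \oo))); apply: cvgB => //.
    by rewrite (cvg_shiftS V).
(* Increments of [x] are bounded by those of [z], and [y n.+1 - x n.+1] is itself an increment of
   [z]. *)
have dy : `|y n.+1 - y n| @[n --> \oo] --> (0 : R).
  rewrite -(cvg_shiftS (fun n => `|y n.+1 - y n|)).
  apply: (@squeeze_cvgr _ _ _ _ (cst 0)
    (fun n => `|z n.+2 - z n.+1| + 2 * `|z n.+1 - z n|)).
  - apply: nearW => n; rewrite /= normr_ge0 /=.
    have /firmly_nonexpansive h :=
      resolvent_firmly _ _ _ _ _ _ g0 mA1 (hx n.+1) (hx n).
    have -> : y n.+2 - y n.+1 =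
        (x n.+2 - x n.+1) + ((z n.+2 - z n.+1) - (z n.+1 - z n)).
      by rewrite !hz; apply: (ip_inj ipP) => w; rewrite !(ipE ipP); ring.
    apply: le_trans (ler_normD _ _) _.
    by have := ler_normB (z n.+2 - z n.+1) (z n.+1 - z n); lra.
  - exact: cvg_cst.
  - have -> : (0 : R) = 0 + 2 * 0 by rewrite mulr0 addr0.
    apply: cvgD; last exact: cvgMl_tmp.
    by rewrite (cvg_shiftS (fun n => `|z n.+1 - z n|)).
have bound a : 1 / 2 * a ^+ 2 <= V 0%N -> a <= V 0%N + 1.
  by have := sqr_ge0 (a - 1); lra.
have zM n : `|z n.+2 - zs| <= V 0%N + 1.
  apply: bound; apply: le_trans (Vle n); apply: le_trans (Vlow n).1.
  by have := sqr_ge0 `|z n.+2 - z n.+1|; lra.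
have dM n : `|z n.+2 - z n.+1| <= V 0%N + 1.
  apply: bound; apply: le_trans (Vle n); apply: le_trans (Vlow n).1.
  by have := sqr_ge0 `|z n.+2 - zs|; lra.
have yM n : `|y n.+2 - p| <= 3 * (V 0%N + 1).
  by apply: le_trans (Vlow n).2 _; have := zM n; have := dM n; lra.
split=> //; first by exists (V 0%N + 1).
pose d n := z n.+1 - z n; pose e n := y n.+1 - y n.
have small (f g : nat -> H) : `|f n| @[n --> \oo] --> (0 : R) ->
    `|g n| @[n --> \oo] --> (0 : R) -> ip (f n) (g n) @[n --> \oo] --> (0 : R).
  move=> f0 g1; apply: (@cvg_ip_bounded _ _ _ ipP _ _ _ f g 1) => //.
  exact: (cvgr_le _ g1).
(* All terms of [V] except the squared distance to [zs] tend to 0, so this distance inherits the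
   limit of [V]. *)
have rest : (V n.+2 - ip (z n.+4 - zs) (z n.+4 - zs)) @[n --> \oo] --> (0 : R).
  have -> : (fun n => V n.+2 - ip (z n.+4 - zs) (z n.+4 - zs)) =
      (fun n => (ip (d n.+3) (d n.+3) +
        2 * gamma * ip (e n.+3) (B (2 *: y n.+3 - y n.+2) - B p) +
        (9 * l + k) * ip (e n.+3) (e n.+3) + 2 * l * ip (e n.+2) (e n.+2)) +
        250 / 23 * l * (3 / 5 * ip (d n.+3) (d n.+3)
          - 9 / 25 * ip (d n.+3) (e n.+3) + 1 / 10 * ip (e n.+3) (e n.+3))).
    by apply/funext => n; rewrite /V /lyap /storage /d /e; ring.
  have d3 : `|d n.+3| @[n --> \oo] --> (0 : R).
    exact: (cvg_shiftl 3 _ _ dz).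
  have e3 : `|e n.+3| @[n --> \oo] --> (0 : R).
    exact: (cvg_shiftl 3 _ _ dy).
  have e2 : `|e n.+2| @[n --> \oo] --> (0 : R).
    exact: (cvg_shiftl 2 _ _ dy).
  have -> : (0 : R) = (0 + 2 * gamma * 0 + (9 * l + k) * 0 + 2 * l * 0) +
      250 / 23 * l * (3 / 5 * 0 - 9 / 25 * 0 + 1 / 10 * 0).
    by ring.
  apply: cvgD; last first.
    apply: cvgMl_tmp; apply: cvgD; last by apply: cvgMl_tmp; apply: small.
    by apply: cvgB; apply: cvgMl_tmp; apply: small.
  apply: cvgD; last by apply: cvgMl_tmp; apply: small.
  apply: cvgD; last by apply: cvgMl_tmp; apply: small.
  apply: cvgD; first exact: small.
  apply: cvgMl_tmp.
  apply: (@cvg_ip_bounded _ _ _ ipP _ _ _ _ _ (L * (9 * (V 0%N + 1)))) => //.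
  apply: nearW => n; apply: le_trans (lB _ _) _.
  apply: ler_wpM2l; first exact: ltW.
  have -> : 2 *: y n.+3 - y n.+2 - p = 2 *: (y n.+3 - p) - (y n.+2 - p).
    by apply: (ip_inj ipP) => w; rewrite !(ipE ipP); ring.
  apply: le_trans (ler_normB _ _) _; rewrite normrZ ger0_norm //.
  by have := yM n; have := yM n.+1; lra.
exists (lim (V @ \oo) - 0); rewrite -(cvg_shiftn 4).
have -> : (fun n => ip (z (n + 4)%N - zs) (z (n + 4)%N - zs)) =
    (fun n => V n.+2) - (fun n => V n.+2 - ip (z n.+4 - zs) (z n.+4 - zs)).
  by apply/funext => n; rewrite !fctE addn4; ring.
apply: cvgB => //.
exact: (cvg_shiftl 2 _ _ Vcvg).
Qed.

(** Splits a relation on the product of two graphs into its factors. If the second summand is always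
    nonnegative, [xb] lies in the second graph and testing there isolates [A1]. Otherwise a
    violating pair forces [A1 xb u], and testing with [(xb, u)] contradicts the violation. *)
Lemma pair_maximal xb u (K : R) (M : H -> H) : 0 < K -> lipschitz_with K M ->
  (forall q1 w1 q2 w2, A1 q1 w1 -> A2 q2 w2 ->
    0 <= ip (xb - q1) (u - w1) + ip (xb - q2) (- u - (w2 + M q2))) ->
  A1 xb u /\ A2 xb (- u - M xb).
Proof.
move=> K0 lM hsum.
have [h2|/existsNP[q2 /existsNP[w2 /not_implyP[A2q /negP]]]] := pselect
    (forall q2 w2, A2 q2 w2 -> 0 <= ip (xb - q2) (- u - (w2 + M q2))).
  have A2x : A2 xb (- u - M xb).
    exact: (maximal_sum_lipschitz ipP _ M K _ _ K0 maxA2 lM h2).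
  split=> //; apply: (maximal_related ipP _ _ _ maxA1) => q1 w1 A1q.
  by have := hsum _ _ _ _ A1q A2x; rewrite subrr (ip0l ipP) addr0.
rewrite -ltNge => neg.
have A1x : A1 xb u.
  apply: (maximal_related ipP _ _ _ maxA1) => q1 w1 A1q.
  by have := hsum _ _ _ _ A1q A2q; lra.
by have := hsum _ _ _ _ A1x A2q; rewrite subrr (ip0l ipP); lra.
Qed.

Lemma resolvent_graph (A : H -> set H) w q :
  resolvent_pt gamma A w q -> A q (gamma^-1 *: (w - q)).
Proof.
move=> [u [Au ->]]; rewrite (addrC q) addrK scalerA mulVf ?gt_eqF //.
by rewrite scale1r.
Qed.

Lemma graph_resolvent (A : H -> set H) w q u :
  A q u -> w = q + gamma *: u -> resolvent_pt gamma A w q.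
Proof. by move=> Au ->; exists u. Qed.

(** Passes to the limit in the monotonicity inequalities for [A1] at [x n.+1] and for [A2 + B + C]
    at [y n.+1], then concludes by [pair_maximal]. *)
Lemma cluster_fixpoint (U : set_system nat) zs p :
  UltraFilter U -> \oo `<=` U -> dr_fixpoint zs p ->
  exists zb xb, [/\ weak_cvg_along ip U z zb,
    weak_cvg_along ip U (fun n => x n.+1) xb,
    weak_cvg_along ip U (fun n => y n.+1) xb & dr_fixpoint zb xb].
Proof.
move=> UU sub fix_p; have [[M zM] dz dy _] := fejer zs p fix_p.
have PU : ProperFilter U by exact: ultra_proper.
have toU (f : nat -> R) (r : R) : f @ \oo --> r -> f @ U --> r.
  by move=> h P Pr; apply: sub; apply: h.
have gV0 : 0 < gamma^-1 by rewrite invr_gt0.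
have zMU : \near U, `|z U - zs| <= M.
  by apply: sub; exists 2%N => // -[|[|n]].
have xz n : `|x n.+1 - p| <= `|z n - zs|.
  apply: firmly_nonexpansive.
  exact: (resolvent_firmly _ _ _ _ _ _ (ltW gamma0) mA1 (hx n) fix_p.1).
have zb1 : \near U, `|z U| <= M + `|zs|.
  apply: filterS zMU => n h; rewrite -(subrK zs (z n)).
  by apply: le_trans (ler_normD _ _) _; rewrite lerD2r.
have xb1 : \near U, `|x U.+1| <= M + `|p|.
  apply: filterS zMU => n h; rewrite -(subrK p (x n.+1)).
  apply: le_trans (ler_normD _ _) _; rewrite lerD2r.
  exact: le_trans (xz n) h.
have yxE n : y n.+1 - x n.+1 = z n.+1 - z n.
  by rewrite hz; apply: (ip_inj ipP) => w; rewrite !(ipE ipP); ring.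
have yx : `|x n.+1 - y n.+1| @[n --> \oo] --> (0 : R).
  by under eq_fun do rewrite distrC yxE.
have yb1 : \near U, `|y U.+1| <= M + `|p| + 1.
  have near1 : \near U, `|x U.+1 - y U.+1| <= 1.
    by have /cvgr_le := toU _ _ yx; apply.
  apply: filterS2 xb1 near1 => n h1 h2.
  have -> : y n.+1 = x n.+1 - (x n.+1 - y n.+1) by rewrite subKr.
  by apply: le_trans (ler_normB _ _) _; apply: lerD.
have [zb wz] := weak_limit_ultra ipP _ _ _ UU zb1.
have [xb wx] := @weak_limit_ultra _ _ _ ipP _ (fun n => x n.+1) _ UU xb1.
have wy : weak_cvg_along ip U (fun n => y n.+1) xb.
  move=> w; rewrite -[X in _ --> X]subr0.
  have -> : (fun n => ip (y n.+1) w) =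
      (fun n => ip (x n.+1) w) - (fun n => ip (x n.+1 - y n.+1) w).
    by apply/funext => n; rewrite !fctE !(ipE ipP); ring.
  apply: cvgB; first exact: wx.
  apply: (@cvg_ip_bounded _ _ _ ipP _ _ _ _ (cst w) `|w|); first exact: toU.
  exact: nearW.
pose a n := gamma^-1 *: (z n - x n.+1).
(* The resolvent equations put [a n] in [A1 (x n.+1)] and [E n - a n] in [(A2 + B + C) (y n.+1)]. *)
pose E n := gamma^-1 *: (x n.+1 - y n.+1)
  + (B (y n.+1) - B (2 *: y n - yp n)) + (C (y n.+1) - C (y n)).
have Ecvg : `|E n| @[n --> \oo] --> (0 : R).
  apply: (@squeeze_cvgr _ _ _ _ (cst 0) (fun n => gamma^-1 * `|x n.+1 - y n.+1|
    + L * (`|y n.+1 - y n| + `|y n - yp n|) + beta^-1 * `|y n.+1 - y n|)).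
  - apply: nearW => n; rewrite /= normr_ge0 /=.
    apply: le_trans (ler_normD _ _) _; apply: lerD; last first.
      exact: cocoercive_lipschitz.
    apply: le_trans (ler_normD _ _) _; apply: lerD.
      by rewrite normrZ gtr0_norm.
    apply: le_trans (lB _ _) _; apply: ler_wpM2l; first exact: ltW.
    have -> : y n.+1 - (2 *: y n - yp n) = (y n.+1 - y n) - (y n - yp n).
      by apply: (ip_inj ipP) => w; rewrite !(ipE ipP); ring.
    exact: ler_normB.
  - exact: cvg_cst.
  - have -> : (0 : R) = gamma^-1 * 0 + L * (0 + 0) + beta^-1 * 0 by ring.
    apply: cvgD; last exact: cvgMl_tmp.
    apply: cvgD; apply: cvgMl_tmp => //.
    apply: cvgD => //; rewrite -(cvg_shiftS (fun n => `|y n - yp n|)).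
    by under eq_fun do rewrite ypS.
pose u := gamma^-1 *: (zb - xb).
have wa : weak_cvg_along ip U a u.
  move=> w; have -> : (fun n => ip (a n) w) =
      (fun n => gamma^-1 * (ip (z n) w - ip (x n.+1) w)).
    by apply/funext => n; rewrite !(ipE ipP).
  by rewrite /u !(ipE ipP); apply: cvgMl_tmp; apply: cvgB; [exact: wz|exact: wx].
have ab1 : \near U, `|a U| <= gamma^-1 * (M + `|zs| + (M + `|p|)).
  apply: filterS2 zb1 xb1 => n h1 h2; rewrite normrZ gtr0_norm // ler_pM2l //.
  by apply: le_trans (ler_normB _ _) _; apply: lerD.
pose N q := B q + C q.
have lN : lipschitz_with (L + beta^-1) N.
  move=> q q'; rewrite /N opprD addrACA mulrDl.
  apply: le_trans (ler_normD _ _) _; apply: lerD; first exact: lB.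
  exact: cocoercive_lipschitz.
have K0 : 0 < L + beta^-1 by rewrite addr_gt0 // invr_gt0.
have [|A1x A2x] := pair_maximal xb u _ N K0 lN.
  move=> q1 w1 q2 w2 A1q A2q.
  pose w2' := w2 + N q2.
  (* The sum of the two monotonicity products, grouped so that every product of two moving vectors
     has a factor tending to 0 in norm. *)
  pose F n := ip (x n.+1 - y n.+1) (a n) + ip (E n) (y n.+1)
    - ip (x n.+1) w1 - ip (a n) q1 + ip q1 w1
    - ip (y n.+1) w2' - (ip (E n) q2 - ip (a n) q2) + ip q2 w2'.
  apply: (@ler_cvg_to nat U _ R (cst 0) F); first exact: cvg_cst.
    have -> : ip (xb - q1) (u - w1) + ip (xb - q2) (- u - (w2 + N q2)) =
        0 + 0 - ip xb w1 - ip u q1 + ip q1 w1 - ip xb w2' - (0 - ip u q2)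
        + ip q2 w2'.
      rewrite /w2'; move: (u) (w2 + N q2) => v W.
      by rewrite !(ipE ipP) (ipC ipP v q1) (ipC ipP v q2); ring.
    apply: cvgD; last exact: cvg_cst.
    apply: cvgB; last first.
      apply: cvgB; last exact: wa.
      apply: (@cvg_ip_bounded _ _ _ ipP _ _ _ _ (cst q2) `|q2|).
        exact: toU.
      exact: nearW.
    apply: cvgB; last exact: wy.
    apply: cvgD; last exact: cvg_cst.
    apply: cvgB; last exact: wa.
    apply: cvgB; last exact: wx.
    apply: cvgD.
      exact: (@cvg_ip_bounded _ _ _ ipP _ _ _ _ _ _ (toU _ _ yx) ab1).
    exact: (@cvg_ip_bounded _ _ _ ipP _ _ _ _ _ _ (toU _ _ Ecvg) yb1).
  apply: nearW => n /=.
  have h1 := mA1 _ _ _ _ (resolvent_graph _ _ _ (hx n)) A1q.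
  have h2 := mA2 _ _ _ _ (resolvent_graph _ _ _ (hy n)) A2q.
  have h3 := mB (y n.+1) q2.
  have h4 : 0 <= ip (y n.+1 - q2) (C (y n.+1) - C q2).
    by apply: le_trans (cC _ _); rewrite mulr_ge0 ?sqr_ge0 // ltW.
  rewrite -/(a n) in h1.
  set v := gamma^-1 *: _ in h2.
  have EE : E n = a n + (v + (B (y n.+1) + C (y n.+1))).
    rewrite /E /a /v; apply: (ip_inj ipP) => w; rewrite !(ipE ipP).
    by field; rewrite gt_eqF.
  rewrite /F EE /w2' /N; move: h1 h2 h3 h4.
  move: (a n) (v) (x n.+1) (y n.+1) (B _) (C _) (B q2) (C q2).
  move=> an v' xn yn By Cy Bq Cq.
  rewrite !(ipE ipP) (ipC ipP xn an) (ipC ipP yn an) (ipC ipP yn v').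
  rewrite (ipC ipP yn By) (ipC ipP yn Cy) (ipC ipP q1 an) (ipC ipP q2 v').
  rewrite (ipC ipP q2 By) (ipC ipP q2 Cy).
  lra.
exists zb, xb; split=> //; split.
  apply: (graph_resolvent _ _ _ _ A1x).
  by rewrite /u scalerA mulfV ?gt_eqF // scale1r addrC subrK.
apply: (graph_resolvent _ _ _ _ A2x).
rewrite /N /u; apply: (ip_inj ipP) => w; rewrite !(ipE ipP).
by field; rewrite gt_eqF.
Qed.

(** Opial's argument: [|z n - zb|^2 - |z n - zb'|^2] converges along [\oo], hence so does
    [<z n, zb' - zb>]. Its limits along [U] and [U'] therefore agree, which gives
    [|zb' - zb|^2 = 0]. *)
Lemma weak_cluster_unique (U U' : set_system nat) zb zb' xb xb' :
  UltraFilter U -> \oo `<=` U -> UltraFilter U' -> \oo `<=` U' ->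
  dr_fixpoint zb xb -> dr_fixpoint zb' xb' ->
  weak_cvg_along ip U z zb -> weak_cvg_along ip U' z zb' ->
  zb = zb' /\ xb = xb'.
Proof.
move=> UU sub UU' sub' f f' wz wz'.
have PU : ProperFilter U by exact: ultra_proper.
have PU' : ProperFilter U' by exact: ultra_proper.
have [_ _ _ [c hc]] := fejer zb xb f; have [_ _ _ [c' hc']] := fejer zb' xb' f'.
pose r := 1 / 2 * (c - c' - ip zb zb + ip zb' zb').
have hr : ip (z n) (zb' - zb) @[n --> \oo] --> r.
  have -> : (fun n => ip (z n) (zb' - zb)) = (fun n => 1 / 2 *
      (ip (z n - zb) (z n - zb) - ip (z n - zb') (z n - zb')
        - ip zb zb + ip zb' zb')).
    apply/funext => n; rewrite !(ipE ipP) (ipC ipP zb (z n)).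
    by rewrite (ipC ipP zb' (z n)); lra.
  apply: cvgMl_tmp; apply: cvgD; last exact: cvg_cst.
  by apply: cvgB; [exact: cvgB|exact: cvg_cst].
have rU : ip zb (zb' - zb) = r.
  apply: (cvg_unique (@norm_hausdorff _ _) (wz (zb' - zb))).
  by move=> P Pr; apply: sub; apply: hr.
have rU' : ip zb' (zb' - zb) = r.
  apply: (cvg_unique (@norm_hausdorff _ _) (wz' (zb' - zb))).
  by move=> P Pr; apply: sub'; apply: hr.
have zE : zb = zb'.
  apply/esym/eqP; rewrite -subr_eq0 -normr_eq0 -sqrf_eq0 -(ip_sq ipP).
  by rewrite (ipDl ipP zb') (ipNl ipP) rU rU' subrr.
split=> //; apply/eqP; rewrite -subr_eq0 -normr_eq0 eq_le normr_ge0 andbT.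
have := resolvent_firmly _ _ _ _ _ _ (ltW gamma0) mA1 f.1 f'.1.
by move/firmly_nonexpansive; rewrite zE subrr normr0.
Qed.

Lemma iteration_weak_cvg zs p : dr_fixpoint zs p ->
  exists zb xb, [/\ weak_cvg ip z zb, weak_cvg ip x xb, weak_cvg ip y xb &
    dr_fixpoint zb xb].
Proof.
move=> fix_p.
(* One ultrafilter fixes the candidate limits; every other one must reproduce them. *)
have [U [UU sub]] := ultraFilterLemma (F := \oo) _.
have [zb [xb [wz wx wy f]]] := cluster_fixpoint _ _ _ UU sub fix_p.
have all G : UltraFilter G -> \oo `<=` G ->
    [/\ weak_cvg_along ip G z zb, weak_cvg_along ip G (fun n => x n.+1) xb &
      weak_cvg_along ip G (fun n => y n.+1) xb].
  move=> UG subG.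
  have [zb' [xb' [wz' wx' wy' f']]] := cluster_fixpoint _ _ _ UG subG fix_p.
  by have [-> ->] := weak_cluster_unique _ _ _ _ _ _ UU sub UG subG f f' wz wz'.
exists zb, xb; split=> // w.
- by apply: cvg_of_ultra => G UG subG; have [h _ _] := all G UG subG; apply: h.
(* The shift skips [x 0], which the recursion does not determine. *)
- rewrite -(cvg_shiftS (fun n => ip (x n) w)).
  by apply: cvg_of_ultra => G UG subG; have [_ h _] := all G UG subG; apply: h.
- rewrite -(cvg_shiftS (fun n => ip (y n) w)).
  by apply: cvg_of_ultra => G UG subG; have [_ _ h] := all G UG subG; apply: h.
Qed.

Lemma dr_fixpoint_zer zs p : dr_fixpoint zs p -> zer4 A1 A2 B C p.
Proof.
move=> [/resolvent_graph A1p /resolvent_graph A2p].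
exists (gamma^-1 *: (zs - p)); eexists; split; [exact: A1p|split; [exact: A2p|]].
apply: (ip_inj ipP) => w; rewrite !(ipE ipP) (ip0l ipP).
by field; rewrite gt_eqF.
Qed.

Lemma zer_dr_fixpoint p : zer4 A1 A2 B C p -> exists zs, dr_fixpoint zs p.
Proof.
move=> [u1 [u2 [A1p [A2p s0]]]]; exists (p + gamma *: u1); split.
  exact: graph_resolvent A1p _.
apply: (graph_resolvent _ _ _ _ A2p).
have -> : u2 = - u1 - B p - C p.
  apply/eqP; rewrite -subr_eq0 -s0; apply/eqP.
  by apply: (ip_inj ipP) => w; rewrite !(ipE ipP); ring.
by apply: (ip_inj ipP) => w; rewrite !(ipE ipP); ring.
Qed.

End Lyapunov.

Theorem theorem3p2 (R : realType) (H : completeNormedModType R)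
  (ip : H -> H -> R) (A1 A2 : H -> set H) (B C : H -> H) (L beta gamma : R)
  (z0 y0 ym1 : H) (x y z : nat -> H) :
  is_inner_product ip ->
  maximally_monotone ip A1 -> maximally_monotone ip A2 ->
  monotone_fun ip B -> 0 < L -> lipschitz_with L B ->
  0 < beta -> cocoercive ip beta C ->
  (exists p, zer4 A1 A2 B C p) ->
  let a := (17 * beta * L + 10
            + Num.sqrt ((17 * beta * L + 10) ^+ 2 + 144 * beta ^+ 2 * L ^+ 2))
           / (6 * beta * L) in
  0 < gamma -> gamma < beta / (5 + (10 + 6 / a) * beta * L) ->
  z 0%N = z0 -> y 0%N = y0 ->
  (forall n : nat,
     let yprev := match n with 0%N => ym1 | S k => y k end in
     resolvent_pt gamma A1 (z n) (x n.+1) /\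
     resolvent_pt gamma A2
       (2 *: x n.+1 - z n - gamma *: B (2 *: y n - yprev) - gamma *: C (y n))
       (y n.+1) /\
     z n.+1 = z n + y n.+1 - x n.+1) ->
  exists zbar xbar : H,
    [/\ weak_cvg ip z zbar,
        weak_cvg ip x xbar, weak_cvg ip y xbar,
        resolvent_pt gamma A1 zbar xbar
      & zer4 A1 A2 B C xbar].
Proof.
move=> ipP maxA1 maxA2 mB L0 lB beta0 cC [p zp] a gamma0 ga _ _ rec.
have [sl sl1] := step_bounds _ _ _ L0 beta0 gamma0 ga.
have [zs fp] := zer_dr_fixpoint ipP (gamma := gamma) p zp.
pose yp n := match n with 0%N => ym1 | S k => y k end.
have [zb [xb [wz wx wy f]]] := iteration_weak_cvg ipP maxA1.1 maxA2.1 mB lB cC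
  L0 beta0 gamma0 sl sl1 maxA1 maxA2 x y yp z (fun=> erefl)
  (fun n => (rec n).1) (fun n => (rec n).2.1) (fun n => (rec n).2.2) zs p fp.
exists zb, xb; split=> //; first exact: f.1.
exact: (dr_fixpoint_zer ipP gamma0 zb xb f).
Qed.
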